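(* Let $N=p_{1}^{\alpha_{1}}\cdots p_{r}^{\alpha_{r}}$ with $r\geq 1$, $p_1,\ldots,p_r$ pairwise distinct prime numbers and $\alpha_1,\ldots,\alpha_r$ positive integers. Let $k=a\,p_{1}^{\beta_{1}}\cdots p_{r}^{\beta_{r}}$ where $1\leq\beta_i\leq\alpha_i$ for all $i$ and $a$ is an integer not divisible by any of the $p_i$. Then the $\overline{k}$-monomial minimal solution of $(E_{N})$ has size $2p_{1}^{\alpha_{1}-\beta_{1}}\cdots p_{r}^{\alpha_{r}-\beta_{r}}$.
   Context: Let $N\geq 2$ be an integer and write $\overline{a}=a+N\mathbb{Z}$ for $a\in\mathbb{Z}$. For $\overline{a_1},\ldots,\overline{a_s}\in\mathbb{Z}/N\mathbb{Z}$ put $$M_s(\overline{a_1},\ldots,\overline{a_s})=\begin{pmatrix}\overline{a_s}&-\overline{1}\\ \overline{1}&\overline{0}\end{pmatrix}\begin{pmatrix}\overline{a_{s-1}}&-\overline{1}\\ \overline{1}&\overline{0}\end{pmatrix}\cdots\begin{pmatrix}\overline{a_1}&-\overline{1}\\ \overline{1}&\overline{0}\end{pmatrix}.$$ A solution of $(E_N)$ of size $s$ ($s\geq 1$) is an $s$-tuple $(\overline{a_1},\ldots,\overline{a_s})\in(\mathbb{Z}/N\mathbb{Z})^s$ with $M_s(\overline{a_1},\ldots,\overline{a_s})=\pm \mathrm{Id}$ over $\mathbb{Z}/N\mathbb{Z}$. For $\overline{k}\in\mathbb{Z}/N\mathbb{Z}$, the $\overline{k}$-monomial minimal solution of $(E_N)$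 is the tuple $(\overline{k},\ldots,\overline{k})$ of size $s$, where $s\geq 1$ is the smallest integer such that the $s$-tuple with all entries equal to $\overline{k}$ is a solution of $(E_N)$ (it exists and is unique). *)

(* Defs.v *)
From HB Require Import structures.
From mathcomp Require Import all_boot all_order all_algebra all_fingroup.

Set Implicit Arguments.
Unset Strict Implicit.
Unset Printing Implicit Defensive.

Import GRing.Theory.
Local Open Scope ring_scope.

(* Z/NZ is 'Z_N throughout, which is the intended ring only for 1 < N. *)

Definition elem_mx (N : nat) (c : 'Z_N) : 'M['Z_N]_2 :=
  \matrix_(i < 2, j < 2)
    if i == 0 then (if j == 0 then c else -1) else (if j == 0 then 1 else 0).

(* The tuple (a_1, ..., a_s) is the sequence [:: a_1; ...; a_s]; the factor of
   the last entry comes leftmost, hence the rev. *)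
Definition M_mx (N : nat) (t : seq 'Z_N) : 'M['Z_N]_2 :=
  \prod_(c <- rev t) elem_mx c.

Definition is_solution (N : nat) (t : seq 'Z_N) : bool :=
  (0 < size t)%N && ((M_mx t == 1%:M) || (M_mx t == - 1%:M)).

Lemma M_mx_nseq (N : nat) (k : 'Z_N) (s : nat) :
  M_mx (nseq s k) = elem_mx k ^+ s.
Proof. by rewrite /M_mx rev_nseq big_nseq -Monoid.iteropE. Qed.

Lemma elem_mx_unit (N : nat) (c : 'Z_N) : elem_mx c \is a GRing.unit.
Proof.
change (elem_mx c \in unitmx); rewrite unitmxE (expand_det_row _ ord0).
rewrite !big_ord_recl big_ord0 /cofactor !det_mx11 !mxE /=.
by rewrite !mulr0 add0r addr0 mulr1 mulrNN mulr1 unitr1.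
Qed.

Lemma ex_monomial_solution (N : nat) (k : 'Z_N) :
  exists s, is_solution (nseq s k).
Proof.
pose u := FinRing.unit 'M['Z_N]_2 (elem_mx_unit k).
exists #[u]%g; rewrite /is_solution size_nseq order_gt0 M_mx_nseq /=.
have -> : elem_mx k ^+ #[u]%g = 1.
  by have := congr1 val (expg_order u); rewrite FinRing.val_unitX.
by rewrite eqxx.
Qed.

Definition monomial_minimal_solution (N : nat) (k : 'Z_N) : seq 'Z_N :=
  nseq (ex_minn (ex_monomial_solution k)) k.

(* Main.v *)
(* Let E be the matrix with rows (k, -1) and (1, 0). Since E^2 = kE - 1, the
   binomial formula gives, with all signs omitted,
   E^(2m) = sum_i C(m, i) k^i E^i, where m C(m - 1, i - 1) = i C(m, i) shows that
   p^(v(m) + i v(k) - v(i)) divides C(m, i) k^i for v the p-adic valuation.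
   For m = prod p_i^(alpha_i - beta_i) this kills all terms with i > 0 modulo N.
   Conversely, if E^s is scalar modulo N then its lower left entry vanishes. That
   entry is 1 or -1 modulo p for s odd, while for s = 2m it has the valuation
   v(m) + v(k) of its term i = 1, so that each alpha - beta is at most v(m). *)

Require Import Defs.
From mathcomp Require Import all_boot all_order all_algebra.
From mathcomp Require Import zify ring.
Import GRing.Theory.
Local Open Scope ring_scope.

(** * Prime powers dividing binomial terms *)

Lemma prime_power_dvd_bin (p e m i : nat) :
  prime p -> (p ^ e %| m)%N -> (0 < i)%N -> (p ^ (e - logn p i) %| 'C(m, i))%N.
Proof.
case: i => // i pp dvd_m _.
have [->|C_gt0] := posnP 'C(m, i.+1); first exact: dvdn0.
have : (p ^ e %| i.+1 * 'C(m, i.+1))%N by rewrite -mul_bin_diag dvdn_mulr.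
rewrite !pfactor_dvdn ?muln_gt0 // lognM //; lia.
Qed.

Lemma logn_lt_id (p i : nat) : prime p -> (0 < i)%N -> (logn p i < i)%N.
Proof.
move=> pp i_gt0; apply: leq_trans (ltn_expl _ (prime_gt1 pp)) _.
exact: dvdn_leq (pfactor_dvdnn p i).
Qed.

(** Otherwise p^(i-1) <= i, whereas p^(i-1) >= 2(i-1) > i for i > 2. The bound fails for p = i =
    2. *)
Lemma logn_add2_le_id (p i : nat) :
  prime p -> (2 < i)%N -> (logn p i + 2 <= i)%N.
Proof.
move=> pp i_gt2; have i_gt0 : (0 < i)%N by lia.
have le_i : (p ^ logn p i <= i)%N := dvdn_leq i_gt0 (pfactor_dvdnn p i).
have p_gt1 := prime_gt1 pp; rewrite leqNgt; apply/negP => lt_i.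
have : (p ^ (i - 2).+1 <= i)%N.
  by apply: leq_trans le_i; rewrite leq_pexp2l ?(ltnW p_gt1) //; lia.
by rewrite expnS; have := ltn_expl (i - 2) p_gt1; nia.
Qed.

Lemma prime_power_dvd_exp_bin (p b e m i : nat) (k : int) :
  prime p -> ((p ^ b)%N %| k)%Z -> (p ^ e %| m)%N -> (0 < i)%N ->
  ((p ^ (b * i + (e - logn p i)))%N %| k ^+ i *+ 'C(m, i))%Z.
Proof.
move=> pp dvd_k dvd_m i_gt0; rewrite -mulr_natr natz expnD PoszM dvdz_mul //.
  by rewrite expnM dvdzE abszX dvdn_exp2r -?dvdzE.
by rewrite dvdzE prime_power_dvd_bin.
Qed.

Lemma coprime_prod_dvd (r : nat) (q : 'I_r -> nat) (x : nat) :
  (forall i j, i != j -> coprime (q i) (q j)) -> (forall i, q i %| x)%N ->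
  (\prod_(i < r) q i %| x)%N.
Proof.
move=> co dvd_x; have := enum_uniq 'I_r; rewrite -big_enum /=.
elim: (enum _) => [|i s IHs] /=; first by rewrite big_nil dvd1n.
case/andP=> nis /IHs dvd_s; rewrite big_cons Gauss_dvd ?dvd_x //.
rewrite big_seq; apply: (big_ind (coprime (q i))); first exact: coprimen1.
  by move=> y z; rewrite coprimeMr => -> ->.
by move=> j js; apply: co; apply: contraNneq nis => ->.
Qed.

Lemma intr_Zp_eq0 (N : nat) (x : int) :
  (1 < N)%N -> ((x%:~R : 'Z_N) == 0) = (N %| x)%Z.
Proof.
move=> N_gt1; have nat_case n : ((n%:R : 'Z_N) == 0) = (N %| n)%N.
  by rewrite -(inj_eq val_inj) /= val_Zp_nat.
case: x => n; first by rewrite -pmulrn nat_case.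
by rewrite NegzE mulrNz oppr_eq0 -pmulrn nat_case dvdzE abszN.
Qed.

Section CompanionMatrix.

Variable R : comNzRingType.
Implicit Type c : R.

(** Same matrix as [elem_mx], but over any commutative ring: valuations are read off over the
    integers, then everything is reduced modulo N. *)
Definition step_mx c : 'M[R]_2 :=
  \matrix_(i < 2, j < 2)
    if i == 0 then (if j == 0 then c else -1) else (if j == 0 then 1 else 0).

Lemma step_mx_sqr c : step_mx c ^+ 2 = - 1 + c *: step_mx c.
Proof.
apply/matrixP=> i j; rewrite expr2 !mxE big_ord_recl big_ord1 !mxE.
by case: i j => [[|[|i]] hi] [[|[|j]] hj] //; rewrite /=; ring.
Qed.

Lemma step_mx_even c m :
  step_mx c ^+ (2 * m) =
  \sum_(i < m.+1) (-1) ^+ (m - i) * (c ^+ i *+ 'C(m, i)) *: step_mx c ^+ i.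
Proof.
rewrite exprM step_mx_sqr exprDn_comm; last exact/commr_sym/commrN1.
apply: eq_bigr => i _; rewrite -[-1 in LHS]scaleN1r !exprZn expr1n.
by rewrite -scalerAl mul1r scalerA scalerMnl mulrnAr.
Qed.

Lemma step_mx_exprSS c s :
  step_mx c ^+ s.+2 = c *: step_mx c ^+ s.+1 - step_mx c ^+ s.
Proof.
by rewrite -[s.+2]addn2 exprD step_mx_sqr mulrDr mulrN1 addrC -scalerAr -exprSr.
Qed.

End CompanionMatrix.
Arguments step_mx {R} c.

Lemma map_step_mx (R : comNzRingType) (k : int) :
  map_mx intr (step_mx k) = step_mx (k%:~R : R).
Proof.
by apply/matrixP=> i j; rewrite !mxE; do 2?case: ifP => _; rewrite ?rmorphN1.
Qed.

(** * Valuations of the Lucas sequence *)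

(* The lower left entry of E^s: the Lucas sequence U_s(k, 1). *)
Definition lucas (k : int) (s : nat) : int := (step_mx k ^+ s) 1 0.

Lemma lucasSS k s : lucas k s.+2 = k * lucas k s.+1 - lucas k s.
Proof. by rewrite /lucas step_mx_exprSS !mxE. Qed.

Lemma lucas0 k : lucas k 0 = 0.
Proof. by rewrite /lucas expr0 mxE. Qed.

Lemma lucas1 k : lucas k 1 = 1.
Proof. by rewrite /lucas expr1 mxE. Qed.

Lemma lucas_even k m :
  lucas k (2 * m) =
  \sum_(i < m.+1) (-1) ^+ (m - i) * (k ^+ i *+ 'C(m, i)) * lucas k i.
Proof.
by rewrite /lucas step_mx_even summxE; apply: eq_bigr => i _; rewrite mxE.
Qed.

(** Modulo p the recurrence becomes U_(s+2) = -U_s, so for odd s the value is 1 or -1. *)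
Lemma odd_lucas_not_dvd (p : nat) (k : int) (s : nat) :
  prime p -> (p %| k)%Z -> (p %| lucas k s)%Z -> ~~ odd s.
Proof.
move=> pp dvd_k; have [n] := ubnP s; elim: n s => // n IHn [|[|s]] //.
  by rewrite lucas1 dvdz1 /= => _ /eqP p1; rewrite p1 in pp.
rewrite lucasSS => lt_s; rewrite rpredBl ?dvdz_mulr //=.
by rewrite negbK; apply: IHn; lia.
Qed.

(* Every term of [lucas_even] with i >= 2 has p-adic valuation larger than that
   of the term i = 1, which is m * k up to sign; for i = 2 and p = 2 this needs
   the extra factor lucas k 2 = k. *)
Lemma lucas_even_dvd (p b d m : nat) (k : int) :
  prime p -> (0 < b)%N -> k != 0 -> logn p `|k| = b ->
  ((p ^ (b + d))%N %| lucas k (2 * m))%Z -> (p ^ d %| m)%N.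
Proof.
move=> pp b_gt0 k_neq0 logk; have [->|m_gt0] := posnP m; first by [].
rewrite pfactor_dvdn // leqNgt => dvd_l; apply/negP=> lt_md.
set e := logn p m in lt_md.
have dvd_k : ((p ^ b)%N %| k)%Z by rewrite dvdzE -logk pfactor_dvdnn.
have dvd_m : (p ^ e %| m)%N := pfactor_dvdnn p m.
(* Since e < d, the hypothesis may be weakened to one power of p more than k m contains. *)
have {}dvd_l : ((p ^ (b + e).+1)%N %| lucas k (2 * m))%Z.
  by apply: dvdz_trans dvd_l; rewrite dvdzE dvdn_exp2l //; lia.
suff : ((p ^ (b + e).+1)%N %| k * m%:Z)%Z.
  rewrite dvdzE abszM /= pfactor_dvdn ?muln_gt0 ?absz_gt0 ?k_neq0 //.
  by rewrite lognM ?absz_gt0 // logk ltnn.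
move: dvd_l; rewrite lucas_even (bigD1 (Ordinal (m_gt0 : 1 < m.+1)%N)) //=.
rewrite rpredDr.
  rewrite expr1 bin1 lucas1 mulr1 -mulr_natr natz.
  by rewrite !dvdzE abszMsign !abszM.
apply: rpred_sum => -[[|[|[|i]]] lt_i] //= _.
- by rewrite lucas0 mulr0 dvdz0.
- rewrite lucasSS lucas1 lucas0 subr0 mulr1 -mulrA dvdz_mull //.
  have dvd_2 := prime_power_dvd_exp_bin _ _ _ _ 2 _ pp dvd_k dvd_m isT.
  apply: dvdz_trans (dvdz_mul dvd_2 dvd_k).
  rewrite -PoszM -expnD dvdzE dvdn_exp2l //.
  by have := logn_lt_id p 2 pp isT; clear -b_gt0; lia.
rewrite dvdz_mulr // dvdz_mull //.
(* For the index j = i + 3, b(j - 1) >= j - 1 >= v(j) + 1, hence b j + e - v(j) >= b + e + 1. *)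
apply: dvdz_trans (prime_power_dvd_exp_bin _ _ _ _ i.+3 _ pp dvd_k dvd_m isT).
rewrite dvdzE dvdn_exp2l //.
by have := logn_add2_le_id p i.+3 pp isT; clear -b_gt0; nia.
Qed.

(** * Solutions modulo N *)

Lemma lucas_solution (N : nat) (k : int) (s : nat) :
  (1 < N)%N -> is_solution (nseq s (k%:~R : 'Z_N)) -> (N %| lucas k s)%Z.
Proof.
move=> N_gt1; rewrite /is_solution M_mx_nseq => /andP[_ sol].
have : (step_mx (k%:~R : 'Z_N) ^+ s) 1 0 = 0.
  by case/orP: sol => /eqP ->; rewrite !mxE ?oppr0.
rewrite -map_step_mx -rmorphXn mxE => /eqP.
by rewrite intr_Zp_eq0.
Qed.

(** Only the term i = 0 of [step_mx_even] survives modulo N, and it is (-1)^m times the identity. *)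
Lemma even_solution (N : nat) (k : int) (m : nat) :
  (1 < N)%N -> (0 < m)%N ->
  (forall i, (0 < i)%N -> (N %| k ^+ i *+ 'C(m, i))%Z) ->
  is_solution (nseq (2 * m) (k%:~R : 'Z_N)).
Proof.
move=> N_gt1 m_gt0 dvd_N.
rewrite /is_solution size_nseq M_mx_nseq muln_gt0 m_gt0.
rewrite -[elem_mx _]/(step_mx _) step_mx_even big_ord_recl big1 /= => [|i _].
  rewrite subn0 expr0 bin0 mulr1 addr0 expr0 -signr_odd.
  by case: odd; rewrite ?expr1 ?expr0 ?scaleN1r ?scale1r eqxx ?orbT.
rewrite -rmorphXn -rmorphMn /=.
have /eqP -> := etrans (intr_Zp_eq0 N _ N_gt1) (dvd_N (lift ord0 i) isT).
by rewrite mulr0 scale0r.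
Qed.

Lemma logn_prod_expn (r : nat) (p b : 'I_r -> nat) (i : 'I_r) :
  (forall j, prime (p j)) -> injective p ->
  logn (p i) (\prod_(j < r) p j ^ b j)%N = b i.
Proof.
move=> pp inj_p; rewrite (bigD1 i) //= mulnC logn_Gauss ?pfactorK //.
apply: (big_ind (coprime (p i))); first exact: coprimen1.
  by move=> y z; rewrite coprimeMr => -> ->.
move=> j ji; rewrite coprimeXr // prime_coprime // dvdn_prime2 //.
by rewrite (inj_eq inj_p) eq_sym.
Qed.

Theorem proposition4p1 (r : nat) (p alpha beta : 'I_r -> nat) (N : nat) (a k : int)
  (hr : (1 <= r)%N)
  (hp : forall i, prime (p i))
  (hinj : injective p)
  (halpha : forall i, (0 < alpha i)%N)
  (hN : N = (\prod_(i < r) p i ^ alpha i)%N)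
  (hbeta : forall i, (1 <= beta i <= alpha i)%N)
  (ha : forall i, ~~ ((p i)%:Z %| a)%Z)
  (hk : k = a * (\prod_(i < r) p i ^ beta i)%N%:Z) :
  size (monomial_minimal_solution (k%:~R : 'Z_N)) =
    (2 * \prod_(i < r) p i ^ (alpha i - beta i))%N.
Proof.
have co (f : 'I_r -> nat) i j : i != j -> coprime (p i ^ f i) (p j ^ f j).
  move=> ij; rewrite coprimeXl // coprimeXr // prime_coprime // dvdn_prime2 //.
  by rewrite (inj_eq hinj).
have prod_gt0 (f : 'I_r -> nat) : (0 < \prod_(i < r) p i ^ f i)%N.
  by apply: prodn_gt0 => i; rewrite expn_gt0 prime_gt0.
have dvd_prod (f : 'I_r -> nat) i : (p i ^ f i %| \prod_(j < r) p j ^ f j)%N.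
  by rewrite (bigD1 i) //= dvdn_mulr.
(* As r >= 1, N is at least one of its prime powers. *)
have N_gt1 : (1 < N)%N.
  pose i0 := Ordinal hr; apply: (@leq_trans (p i0 ^ alpha i0)).
    by rewrite -(exp1n (alpha i0)) ltn_exp2r ?prime_gt1.
  by rewrite hN dvdn_leq.
have dvd_k i : ((p i ^ beta i)%N %| k)%Z.
  by rewrite hk dvdz_mull // dvdzE dvd_prod.
have a_neq0 : a != 0.
  by apply: contraNneq (ha (Ordinal hr)) => ->; rewrite dvdz0.
have k_neq0 : k != 0 by rewrite hk mulf_neq0 // -lt0n prod_gt0.
have log_k i : logn (p i) `|k| = beta i.
  rewrite hk abszM logn_Gauss ?logn_prod_expn // prime_coprime //.
  by rewrite -[p i]absz_nat -dvdzE.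
rewrite /monomial_minimal_solution size_nseq; case: ex_minnP => s sol_s min_s.
set m := (\prod_(i < r) p i ^ (alpha i - beta i))%N.
(* Minimality gives s <= 2m once 2m is shown to be the size of a solution. *)
apply/eqP; rewrite eqn_leq min_s /=; last first.
  apply: even_solution => // [|i i_gt0]; first exact: prod_gt0.
  rewrite dvdzE hN absz_nat.
  apply: coprime_prod_dvd (co _) _ => j.
  have := prime_power_dvd_exp_bin _ _ _ m i k
    (hp j) (dvd_k j) (dvd_prod _ j) i_gt0.
  apply: dvdn_trans; apply: dvdn_exp2l.
  (* The exponent reaches alpha because beta(i - 1) >= i - 1 >= v(i). *)
  by have := logn_lt_id _ i (hp j) i_gt0; have := hbeta j; nia.
have dvd_s i : ((p i ^ alpha i)%N %| lucas k s)%Z.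
  apply: dvdz_trans (lucas_solution _ _ _ N_gt1 sol_s).
  by rewrite hN dvdzE dvd_prod.
have s_even : ~~ odd s.
  have dvd_p (f : 'I_r -> nat) i : (0 < f i)%N -> (p i %| (p i ^ f i)%N%:Z)%Z.
    by move=> f_gt0; rewrite dvdzE dvdn_exp.
  apply: (odd_lucas_not_dvd (p (Ordinal hr)) k) => //.
    apply: dvdz_trans (dvd_k _); apply: dvd_p.
    by have /andP[] := hbeta (Ordinal hr).
  exact: dvdz_trans (dvd_p _ _ (halpha _)) (dvd_s _).
have def_s : s = (2 * s./2)%N by rewrite mul2n even_halfK.
have s_gt0 : (0 < s./2)%N by case/andP: sol_s; rewrite size_nseq; lia.
(* The bound m <= s/2 comes from m dividing s/2, checked one prime power at a time. *)
rewrite def_s leq_pmul2l // dvdn_leq //; apply: coprime_prod_dvd (co _) _ => i.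
have /andP[b_gt0 b_le] := hbeta i.
apply: lucas_even_dvd (hp i) b_gt0 k_neq0 (log_k i) _.
by rewrite subnKC // -def_s.
Qed.
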